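(* Let $\mathcal{Q}$ be a seminormal quasi-crystal. Then the hypoplactic congruence $\ddot{\sim}$ on the free quasi-crystal monoid $\mathcal{Q}^{*}$ is a quasi-crystal monoid congruence on $\mathcal{Q}^{*}$.
   Context: Root system data: $V$ a finite-dimensional real inner product space, $\alpha^\vee=\frac{2}{\langle\alpha,\alpha\rangle}\alpha$; a root system $\Phi$ with fixed simple roots $(\alpha_i)_{i\in I}$ and weight lattice $\Lambda$ (a $\mathbb{Z}$-submodule of $V$ spanning $V$, containing $\Phi$, with $\langle\lambda,\alpha^\vee\rangle\in\mathbb{Z}$ for $\alpha\in\Phi$). A quasi-crystal of type $\Phi$ is a set $Q$ with maps $\mathrm{wt}:Q\to\Lambda$, $\ddot{e}_i,\ddot{f}_i:Q\to Q\sqcup\{\bot\}$ ($\bot$ = undefined), $\ddot{\varepsilon}_i,\ddot{\varphi}_i:Q\to\mathbb{Z}\cup\{\pm\infty\}$ ($i\in I$) such that: $\ddot{\varphi}_i(x)=\ddot{\varepsilon}_i(x)+\langle\mathrm{wt}(x),\alpha_i^\vee\rangle$ (with $m+(\pm\infty)=\pm\infty$); if $\ddot{e}_i(x)\in Q$ then $\mathrm{wt}(\ddot{e}_i(x))=\mathrm{wt}(x)+\alpha_i$, $\ddot{\varepsilon}_i(\ddot{e}_i(x))=\ddot{\varepsilon}_i(x)-1$, $\ddot{\varphi}_i(\ddot{e}_i(x))=\ddot{\varphi}_i(x)+1$; if $\ddot{f}_i(x)\in Q$ then $\mathrm{wt}(\ddot{f}_i(x))=\mathrm{wt}(x)-\alpha_i$,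 $\ddot{\varepsilon}_i(\ddot{f}_i(x))=\ddot{\varepsilon}_i(x)+1$, $\ddot{\varphi}_i(\ddot{f}_i(x))=\ddot{\varphi}_i(x)-1$; $\ddot{e}_i(x)=y\iff x=\ddot{f}_i(y)$; $\ddot{\varepsilon}_i(x)=\pm\infty$ implies $\ddot{e}_i(x)=\ddot{f}_i(x)=\bot$. Seminormal: whenever $\ddot{\varepsilon}_i(x)\ne+\infty$, $\ddot{\varepsilon}_i(x)=\max\{k\ge0:\ddot{e}_i^k(x)\in Q\}$ and $\ddot{\varphi}_i(x)=\max\{k\ge0:\ddot{f}_i^k(x)\in Q\}$. A quasi-crystal isomorphism between quasi-crystals with underlying sets $X,Y$ is a bijection $\psi:X\to Y$ such that $\mathrm{wt},\ddot{\varepsilon}_i,\ddot{\varphi}_i$ are preserved and, for all $x\in X$ and $i$, $\ddot{e}_i(\psi(x))$ is defined iff $\ddot{e}_i(x)$ is, in which case $\psi(\ddot{e}_i(x))=\ddot{e}_i(\psi(x))$, and likewise for $\ddot{f}_i$. The free quasi-crystal monoid $\mathcal{Q}^{*}$: the free monoid $Q^*$ with: for the empty word, $\mathrm{wt}=0$, $\ddot{\varepsilon}_i=\ddot{\varphi}_i=0$, $\ddot{e}_i,\ddot{f}_i$ undefined; for $w=x_1\cdots x_m$ ($x_k\in Q$, $m\ge1$), $\mathrm{wt}(w)=\sum_k\mathrm{wt}(x_k)$, and for $i\in I$ with $p=\max\{k:\ddot{\varepsilon}_i(x_k)>0\}$, $q=\min\{l:\ddot{\varphi}_i(x_l)>0\}$: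 if some $\ddot{\varepsilon}_i(x_k)=+\infty$, or $p,q$ exist with $p>q$, then $\ddot{\varepsilon}_i(w)=\ddot{\varphi}_i(w)=+\infty$ and $\ddot{e}_i(w),\ddot{f}_i(w)$ undefined; otherwise $\ddot{\varepsilon}_i(w)=\sum_k\ddot{\varepsilon}_i(x_k)$, $\ddot{\varphi}_i(w)=\sum_k\ddot{\varphi}_i(x_k)$, $\ddot{e}_i(w)$ is defined iff $p$ exists and is then $w$ with $x_p$ replaced by $\ddot{e}_i(x_p)$, and $\ddot{f}_i(w)$ is defined iff $q$ exists and is then $w$ with $x_q$ replaced by $\ddot{f}_i(x_q)$. For $w\in Q^*$, its connected component $Q^*(w)$ is the set of words obtained from $w$ by finitely many (defined) applications of operators $\ddot{e}_i,\ddot{f}_i$, with the restricted structure. The hypoplactic congruence: $u\ddot{\sim}v$ iff there is a quasi-crystal isomorphism $\psi:Q^*(u)\to Q^*(v)$ with $\psi(u)=v$. A quasi-crystal monoid congruence on $\mathcal{Q}^{*}$ is an equivalence relation $\theta$ on $Q^*$ such that: $(x,y)\in\theta$ implies $\mathrm{wt}(x)=\mathrm{wt}(y)$, $\ddot{\varepsilon}_i(x)=\ddot{\varepsilon}_i(y)$, $\ddot{\varphi}_i(x)=\ddot{\varphi}_i(y)$ for all $i$; if $(x,y)\in\theta$ and $\ddot{e}_i(x)$ is defined then $(\ddot{e}_i(x),\ddot{e}_i(y))\in\theta$; likewise for $\ddot{f}_i$; and $(x_1,y_1),(x_2,y_2)\in\theta$ imply $(x_1x_2,y_1y_2)\in\theta$.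 *)

(* Defs.v *)
From HB Require Import structures.
From Stdlib Require Import Relation_Operators RelationClasses.
From mathcomp Require Import all_boot all_order all_algebra.
From mathcomp Require Import boolp classical_sets cardinality.
From mathcomp Require Import reals constructive_ereal.

Set Implicit Arguments.
Unset Strict Implicit.
Unset Printing Implicit Defensive.

Import Order.TTheory GRing.Theory Num.Theory.
Local Open Scope ring_scope.

Section RootSystems.
Context {R : realType} {V : vectType R}.
Variable ip : {dot V for idfun}.

Definition coroot (a : V) : V := (2 / ip a a) *: a.

Definition reflection (a v : V) : V := v - ip v (coroot a) *: a.

(* Reduced and crystallographic; the roots are not required to span V. *)
Record root_system (Phi : set V) : Prop := RootSystem {
  rs_finite : finite_set Phi;
  rs_neq0 : ~ Phi 0;
  rs_reflection : forall a b, Phi a -> Phi b -> Phi (reflection a b);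
  rs_integral : forall a b, Phi a -> Phi b -> ip b (coroot a) \is a Num.int;
  rs_reduced : forall a (c : R), Phi a -> Phi (c *: a) -> c = 1 \/ c = -1
}.

(* Linear independence of the list of all alpha i makes alpha injective. *)
Record simple_roots (Phi : set V) (I : finType) (alpha : I -> V) : Prop :=
  SimpleRoots {
    sr_root : forall i, Phi (alpha i);
    sr_free : free [seq alpha i | i : I];
    sr_decomp : forall b, Phi b -> exists c : I -> nat,
      b = \sum_i alpha i *+ c i \/ b = - \sum_i alpha i *+ c i
  }.

Record weight_lattice (Phi Lambda : set V) : Prop := WeightLattice {
  wl_0 : Lambda 0;
  wl_sub : forall u v, Lambda u -> Lambda v -> Lambda (u - v);
  wl_span : exists2 s : seq V,
    (forall v, v \in s -> Lambda v) & <<s>>%VS = fullv;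
  wl_root : forall a, Phi a -> Lambda a;
  wl_integral : forall u a, Lambda u -> Phi a -> ip u (coroot a) \is a Num.int
}.

End RootSystems.

(* The maps of a quasi-crystal, without the axioms. None stands for
   "undefined", and Z \cup {-oo, +oo} is \bar int. *)
Record qc_data (V I : Type) := QcData {
  qc_carrier :> Type;
  qc_wt : qc_carrier -> V;
  qc_e : I -> qc_carrier -> option qc_carrier;
  qc_f : I -> qc_carrier -> option qc_carrier;
  qc_eps : I -> qc_carrier -> \bar int;
  qc_phi : I -> qc_carrier -> \bar int
}.

Record quasi_crystal (R : realType) (V : vectType R) (ip : {dot V for idfun})
    (I : finType) (alpha : I -> V) (Lambda : set V) (Q : qc_data V I) : Prop :=
  QuasiCrystal {
    qc_wt_in : forall x : Q, Lambda (qc_wt x);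
    qc_phiE : forall i (x : Q),
      exists2 m : int, ip (qc_wt x) (coroot ip (alpha i)) = m%:~R
                     & qc_phi i x = (qc_eps i x + m%:E)%E;
    qc_e_ax : forall i (x y : Q), qc_e i x = Some y ->
      [/\ qc_wt y = qc_wt x + alpha i,
          qc_eps i y = (qc_eps i x - 1%:E)%E
        & qc_phi i y = (qc_phi i x + 1%:E)%E];
    qc_f_ax : forall i (x y : Q), qc_f i x = Some y ->
      [/\ qc_wt y = qc_wt x - alpha i,
          qc_eps i y = (qc_eps i x + 1%:E)%E
        & qc_phi i y = (qc_phi i x - 1%:E)%E];
    qc_ef : forall i (x y : Q), qc_e i x = Some y <-> qc_f i y = Some x;
    qc_infty : forall i (x : Q), qc_eps i x = +oo%E \/ qc_eps i x = -oo%E ->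
      qc_e i x = None /\ qc_f i x = None
  }.

Definition is_maximum (A : nat -> Prop) (m : nat) : Prop :=
  A m /\ forall k, A k -> (k <= m)%N.

Definition iter_defined (T : Type) (g : T -> option T) (x : T) (k : nat) : Prop :=
  iter k (obind g) (Some x) <> None.

Definition seminormal (V I : Type) (Q : qc_data V I) : Prop :=
  forall i (x : Q), qc_eps i x <> +oo%E ->
    (exists2 m : nat, qc_eps i x = (m%:Z)%:E
                    & is_maximum (iter_defined (qc_e i) x) m)
    /\ (exists2 m : nat, qc_phi i x = (m%:Z)%:E
                       & is_maximum (iter_defined (qc_f i) x) m).

Record qc_isomorphism (V I : Type) (X Y : qc_data V I) (psi : X -> Y) : Prop :=
  QcIsomorphism {
    qi_bij : bijective psi;
    qi_wt : forall x, qc_wt (psi x) = qc_wt x;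
    qi_eps : forall i x, qc_eps i (psi x) = qc_eps i x;
    qi_phi : forall i x, qc_phi i (psi x) = qc_phi i x;
    qi_e : forall i x, qc_e i (psi x) = omap psi (qc_e i x);
    qi_f : forall i x, qc_f i (psi x) = omap psi (qc_f i x)
  }.

(* The increasing list of the positions (counted from 0) of the letters of w
   that satisfy P. *)
Definition positions (T : Type) (P : pred T) (w : seq T) : seq nat :=
  [seq k <- iota 0 (size w) | oapp P false (onth w k)].

Definition first_position (T : Type) (P : pred T) (w : seq T) : option nat :=
  ohead (positions P w).

Definition last_position (T : Type) (P : pred T) (w : seq T) : option nat :=
  ohead (rev (positions P w)).

Definition act_at (T : Type) (g : T -> option T) (k : nat) (w : seq T) :
    option (seq T) :=
  obind (fun x => omap (fun y => set_nth y w k y) (g x)) (onth w k).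

Section FreeMonoid.
Context {V : nmodType} {I : Type}.
Variable Q : qc_data V I.
Implicit Types (i : I) (w : seq Q).

Definition word_p i w : option nat :=
  last_position (fun x : Q => 0%:E < qc_eps i x)%E w.

Definition word_q i w : option nat :=
  first_position (fun x : Q => 0%:E < qc_phi i x)%E w.

Definition word_infinite i w : bool :=
  has (fun x : Q => qc_eps i x == +oo%E) w
  || (if (word_p i w, word_q i w) is (Some p, Some q) then (q < p)%N else false).

(* On the empty word there is no p and no q and the sums are empty, so the
   formulas below yield weight 0, eps = phi = 0 and e, f undefined.
   When Q is seminormal and w is not infinite, e (resp. f) is defined on the
   letter in position p (resp. q), so act_at never yields None there. *)
Definition free_qc : qc_data V I := {|
  qc_carrier := seq Q;
  qc_wt w := \sum_(x <- w) qc_wt x;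
  qc_e i w := if word_infinite i w then None
              else obind (fun p => act_at (qc_e i) p w) (word_p i w);
  qc_f i w := if word_infinite i w then None
              else obind (fun q => act_at (qc_f i) q w) (word_q i w);
  qc_eps i w := if word_infinite i w then +oo%E
                else (\sum_(x <- w) qc_eps i x)%E;
  qc_phi i w := if word_infinite i w then +oo%E
                else (\sum_(x <- w) qc_phi i x)%E
|}.

End FreeMonoid.

Section Components.
Context {V I : Type}.
Variable Q : qc_data V I.

Definition qc_step (x y : Q) : Prop :=
  exists i, qc_e i x = Some y \/ qc_f i x = Some y.

Definition connected : Q -> Q -> Prop := clos_refl_trans Q qc_step.

Variable x : Q.

Definition component_type : Type := {y : Q | connected x y}.

Lemma connected_e i y z : connected x y -> qc_e i y = Some z -> connected x z.
Proof. by move=> xy yz; apply: rt_trans xy (rt_step _ _ _ _ _); exists i; left. Qed.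

Lemma connected_f i y z : connected x y -> qc_f i y = Some z -> connected x z.
Proof. by move=> xy yz; apply: rt_trans xy (rt_step _ _ _ _ _); exists i; right. Qed.

Definition restrict (g : Q -> option Q)
    (gP : forall y z, connected x y -> g y = Some z -> connected x z)
    (y : component_type) : option component_type :=
  match g (sval y) as o return g (sval y) = o -> option component_type with
  | Some z => fun yz => Some (exist _ z (gP _ _ (svalP y) yz))
  | None => fun=> None
  end erefl.

Definition component : qc_data V I := {|
  qc_carrier := component_type;
  qc_wt y := qc_wt (sval y);
  qc_e i := restrict (@connected_e i);
  qc_f i := restrict (@connected_f i);
  qc_eps i y := qc_eps i (sval y);
  qc_phi i y := qc_phi i (sval y)
|}.

Definition component_base : component := exist _ x (rt_refl _ _ x).

End Components.

Definition hypoplactic (V : nmodType) (I : Type) (Q : qc_data V I)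
    (u v : free_qc Q) : Prop :=
  exists psi : component u -> component v,
    qc_isomorphism psi /\ psi (component_base u) = component_base v.

(* The monoid structure of the free quasi-crystal monoid is concatenation. *)
Record qc_monoid_congruence (V : nmodType) (I : Type) (Q : qc_data V I)
    (theta : free_qc Q -> free_qc Q -> Prop) : Prop := QcMonoidCongruence {
  qmc_equiv : Equivalence theta;
  qmc_wt : forall x y, theta x y -> qc_wt x = qc_wt y;
  qmc_eps : forall x y, theta x y -> forall i, qc_eps i x = qc_eps i y;
  qmc_phi : forall x y, theta x y -> forall i, qc_phi i x = qc_phi i y;
  qmc_e : forall x y i x', theta x y -> qc_e i x = Some x' ->
    exists2 y', qc_e i y = Some y' & theta x' y';
  qmc_f : forall x y i x', theta x y -> qc_f i x = Some x' ->
    exists2 y', qc_f i y = Some y' & theta x' y';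
  qmc_mul : forall x1 y1 x2 y2 : seq Q,
    theta x1 y1 -> theta x2 y2 -> theta (x1 ++ x2) (y1 ++ y2)
}.

(* Main.v *)
Require Import Defs.
From Stdlib Require Import Relation_Operators RelationClasses.
From mathcomp Require Import all_boot all_order all_algebra.
From mathcomp Require Import boolp classical_sets reals constructive_ereal.
Import Order.TTheory GRing.Theory Num.Theory.
Local Open Scope ring_scope.

Set Implicit Arguments.
Unset Strict Implicit.

(** Two words are hypoplactic-equivalent iff they are related by some partial
    bijection which preserves wt, eps, phi and matches the (un)definedness and
    the values of the operators: such a relation restricts to an isomorphism of
    components, and conversely the graph of an isomorphism is one.  Hence
    everything but the compatibility with products is formal.  For products,
    whether a concatenation uv is infinite, and on which factor e_i and f_i act,
    only depends on eps_i and phi_i of u and v, by seminormality; so two such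
    relations can be multiplied.  The product is still a partial bijection
    because the operators preserve lengths, so the cut point is known. *)

(** * Partial isomorphisms and isomorphisms of connected components *)

Definition option_rel {X Y : Type} (S : X -> Y -> Prop)
    (a : option X) (b : option Y) : Prop :=
  match a, b with
  | Some x, Some y => S x y
  | None, None => True
  | _, _ => False
  end.

Record partial_isomorphism {V I : Type} {X Y : qc_data V I}
    (S : X -> Y -> Prop) : Prop := PartialIsomorphism {
  pi_fun : forall x y y', S x y -> S x y' -> y = y';
  pi_inj : forall x x' y, S x y -> S x' y -> x = x';
  pi_wt : forall x y, S x y -> qc_wt x = qc_wt y;
  pi_eps : forall i x y, S x y -> qc_eps i x = qc_eps i y;
  pi_phi : forall i x y, S x y -> qc_phi i x = qc_phi i y;
  pi_e : forall i x y, S x y -> option_rel S (qc_e i x) (qc_e i y);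
  pi_f : forall i x y, S x y -> option_rel S (qc_f i x) (qc_f i y)
}.

Section PartialIsomorphisms.
Context {V I : Type}.
Implicit Types X Y Z : qc_data V I.

Lemma partial_isomorphism_eq X : partial_isomorphism (@eq X).
Proof.
split=> [x y y' <- <-|x x' y -> <-|x y ->|i x y ->|i x y ->|i x y ->|i x y ->] //.
- by case: (qc_e i y).
- by case: (qc_f i y).
Qed.

Lemma partial_isomorphism_sym X Y (S : X -> Y -> Prop) :
  partial_isomorphism S -> partial_isomorphism (fun y x => S x y).
Proof.
case=> Sfun Sinj Swt Seps Sphi Se Sf; split.
- by move=> y x x'; apply: Sinj.
- by move=> y y' x; apply: Sfun.
- by move=> y x /Swt.
- by move=> i y x /(Seps i).
- by move=> i y x /(Sphi i).
- by move=> i y x /(Se i); case: (qc_e i x); case: (qc_e i y).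
- by move=> i y x /(Sf i); case: (qc_f i x); case: (qc_f i y).
Qed.

Lemma partial_isomorphism_comp X Y Z (S : X -> Y -> Prop) (T : Y -> Z -> Prop) :
  partial_isomorphism S -> partial_isomorphism T ->
  partial_isomorphism (fun x z => exists2 y, S x y & T y z).
Proof.
move=> pS pT; split.
- move=> x z z' [y xy yz] [y' xy' yz'].
  by move: yz'; rewrite -(pi_fun pS xy xy'); apply: (pi_fun pT).
- move=> x x' z [y xy yz] [y' xy' yz'].
  by move: xy'; rewrite -(pi_inj pT yz yz'); apply: (pi_inj pS).
- by move=> x z [y /(pi_wt pS)-> /(pi_wt pT)].
- by move=> i x z [y /(pi_eps pS)-> /(pi_eps pT)].
- by move=> i x z [y /(pi_phi pS)-> /(pi_phi pT)].
- move=> i x z [y /(pi_e pS i) + /(pi_e pT i)].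
  by case: (qc_e i x) (qc_e i y) (qc_e i z) => [x'|] [y'|] [z'|] //= ? ?; exists y'.
- move=> i x z [y /(pi_f pS i) + /(pi_f pT i)].
  by case: (qc_f i x) (qc_f i y) (qc_f i z) => [x'|] [y'|] [z'|] //= ? ?; exists y'.
Qed.

(** Path lifting: [pi_e] and [pi_f] transport each step of a path from [x], hence by induction on
    the closure the whole path. *)
Lemma partial_isomorphism_connected X Y (S : X -> Y -> Prop) :
  partial_isomorphism S ->
  forall x x', connected x x' ->
  forall y, S x y -> exists2 y', connected y y' & S x' y'.
Proof.
move=> pS x x'; elim=> {x x'} [x x' [i xx'] y xy|x y xy|x1 x2 x3 _ IH1 _ IH2 y].
- case: xx' => xx'.
  + move: (pi_e pS i xy); rewrite xx'; case yy': (qc_e i y) => [y'|] //= Sy'.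
    by exists y' => //; apply: rt_step; exists i; left.
  + move: (pi_f pS i xy); rewrite xx'; case yy': (qc_f i y) => [y'|] //= Sy'.
    by exists y' => //; apply: rt_step; exists i; right.
- by exists y => //; apply: rt_refl.
- move=> /IH1[y2 yy2 /IH2[y3 y23 S3]].
  by exists y3 => //; apply: rt_trans y23.
Qed.

Lemma component_inj X (x : X) (c d : component x) : sval c = sval d -> c = d.
Proof.
case: c d => [c pc] [d pd] /= cd; case: _ / cd pd => pd.
by rewrite (Prop_irrelevance pc pd).
Qed.

Lemma sval_restrict X (x : X) (g : X -> option X) gP (c : component x) :
  omap sval (@restrict V I X x g gP c) = g (sval c).
Proof.
(* The match in [restrict] consumes a proof that [g (sval c)] equals the matched option; both the
   option and this proof are generalized so that case analysis is well typed. *)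
have aux o (E : g (sval c) = o) (k : forall z, g (sval c) = Some z -> connected x z) :
  omap sval (match o as o' return g (sval c) = o' -> option (component_type x) with
  | Some z => fun yz => Some (exist _ z (k z yz))
  | None => fun=> None end E) = o.
  by case: o E.
exact: (aux _ erefl (fun z => gP _ z (svalP c))).
Qed.

Lemma sval_component_e X (x : X) i (c : component x) :
  omap sval (qc_e i c) = qc_e i (sval c).
Proof. exact: sval_restrict. Qed.

Lemma sval_component_f X (x : X) i (c : component x) :
  omap sval (qc_f i c) = qc_f i (sval c).
Proof. exact: sval_restrict. Qed.

(** Path lifting gives every point of the first component a related point in the second, and choice
    turns this into a map. *)
Lemma component_embedding X Y (S : X -> Y -> Prop) (x : X) (y : Y) :
  partial_isomorphism S -> S x y ->
  exists psi : component x -> component y, forall c, S (sval c) (sval (psi c)).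
Proof.
move=> pS xy.
have ex (c : component x) : exists d : component y, S (sval c) (sval d).
  have [z yz Sz] := partial_isomorphism_connected pS (svalP c) xy.
  by exists (exist _ z yz).
by exists (fun c => sval (cid (ex c))) => c; apply: svalP (cid (ex c)).
Qed.

(** Removes the subtypes from the definition of the congruence: what follows works with relations on
    words only. *)
Lemma component_isomorphismP X Y (x : X) (y : Y) :
  (exists psi : component x -> component y,
     qc_isomorphism psi /\ psi (component_base x) = component_base y) <->
  (exists2 S : X -> Y -> Prop, partial_isomorphism S & S x y).
Proof.
split=> [[psi [iso base]]|[S pS Sxy]].
  (* The graph of [psi], pushed forward to the ambient quasi-crystals along [sval]. *)
  exists (fun a b => exists2 c : component x, sval c = a & sval (psi c) = b); last first.
    by exists (component_base x); rewrite ?base.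
  have [psi' psiK psi'K] := qi_bij iso.
  split.
  - by move=> a b b' [c <- <-] [c' /component_inj-> <-].
  - move=> a a' b [c <- <-] [c' <-] /component_inj /(can_inj psiK) -> //.
  - by move=> a b [c <- <-]; apply: esym (qi_wt iso c).
  - by move=> i a b [c <- <-]; apply: esym (qi_eps iso i c).
  - by move=> i a b [c <- <-]; apply: esym (qi_phi iso i c).
  - move=> i a b [c <- <-].
    rewrite -(sval_component_e i c) -(sval_component_e i (psi c)) (qi_e iso).
    by case: (qc_e i c) => //= d; exists d.
  - move=> i a b [c <- <-].
    rewrite -(sval_component_f i c) -(sval_component_f i (psi c)) (qi_f iso).
    by case: (qc_f i c) => //= d; exists d.
have [psi psiS] := component_embedding pS Sxy.
have [psi' psi'S] := component_embedding (partial_isomorphism_sym pS) Sxy.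
exists psi; split; last first.
  by apply: component_inj; apply: (pi_fun pS (psiS (component_base x)) Sxy).
split.
- exists psi' => c; apply: component_inj.
  + exact: (pi_inj pS (psi'S _) (psiS _)).
  + exact: (pi_fun pS (psiS _) (psi'S _)).
- by move=> c; rewrite /= (pi_wt pS (psiS c)).
- by move=> i c; rewrite /= (pi_eps pS i (psiS c)).
- by move=> i c; rewrite /= (pi_phi pS i (psiS c)).
- move=> i c; have := pi_e pS i (psiS c).
  rewrite -!sval_component_e.
  case: (qc_e i c) (qc_e i (psi c)) => [d|] [d'|] //= dd'.
  by rewrite (component_inj (pi_fun pS dd' (psiS d))).
- move=> i c; have := pi_f pS i (psiS c).
  rewrite -!sval_component_f.
  case: (qc_f i c) (qc_f i (psi c)) => [d|] [d'|] //= dd'.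
  by rewrite (component_inj (pi_fun pS dd' (psiS d))).
Qed.

End PartialIsomorphisms.

(** * Positions and letter replacement in concatenated words *)

Section Positions.
Context {T : Type}.
Implicit Types (P : pred T) (u v : seq T) (g : T -> option T).

Lemma positions_cat P u v :
  positions P (u ++ v) = positions P u ++ map (addn (size u)) (positions P v).
Proof.
rewrite /positions size_cat iotaD filter_cat add0n; congr (_ ++ _).
  apply: eq_in_filter => k; rewrite mem_iota add0n => /= ku.
  by rewrite onth_cat ku.
rewrite -[X in iota X _]addn0 iotaDl filter_map; congr map.
by apply: eq_filter => k /=; rewrite onth_cat ltnNge leq_addr addKn.
Qed.

Lemma positions_lt P u k : k \in positions P u -> (k < size u)%N.
Proof. by rewrite mem_filter mem_iota add0n => /andP[_]. Qed.

Lemma first_position_lt P u k : first_position P u = Some k -> (k < size u)%N.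
Proof.
rewrite /first_position => E; apply: (@positions_lt P).
by case: (positions P u) E => //= a s [->]; rewrite inE eqxx.
Qed.

Lemma last_position_lt P u k : last_position P u = Some k -> (k < size u)%N.
Proof.
rewrite /last_position => E; apply: (@positions_lt P); rewrite -mem_rev.
by case: (rev _) E => //= a s [->]; rewrite inE eqxx.
Qed.

Lemma first_position_cat P u v :
  first_position P (u ++ v) =
  if first_position P u is Some k then Some k
  else omap (addn (size u)) (first_position P v).
Proof.
by rewrite /first_position positions_cat; case: (positions P u); case: (positions P v).
Qed.

Lemma last_position_cat P u v :
  last_position P (u ++ v) =
  if last_position P v is Some k then Some (size u + k)%N else last_position P u.
Proof.
rewrite /last_position positions_cat rev_cat -map_rev.
by case: (rev (positions P v)).
Qed.

(** Trades the existence of a position for a property of the letters, which the sums of [eps] and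
    [phi] can detect. *)
Lemma positions_has P u : has predT (positions P u) = has P u.
Proof.
elim: u => // x u IH; rewrite -cat1s positions_cat !has_cat has_map IH.
by rewrite /positions /= orbF; case: (P x).
Qed.

Lemma first_position_has P u : isSome (first_position P u) = has P u.
Proof. by rewrite -positions_has /first_position; case: positions. Qed.

Lemma last_position_has P u : isSome (last_position P u) = has P u.
Proof. by rewrite -positions_has -has_rev /last_position; case: rev. Qed.

Lemma cat_injective u u' v v' :
  size u = size u' -> u ++ v = u' ++ v' -> u = u' /\ v = v'.
Proof.
move=> uu' uv; split.
  by rewrite -(take_size_cat v (erefl (size u))) uv uu' take_size_cat.
by rewrite -(drop_size_cat v (erefl (size u))) uv uu' drop_size_cat.
Qed.

Lemma set_nth_catl (x0 y : T) k u v : (k < size u)%N ->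
  set_nth x0 (u ++ v) k y = set_nth x0 u k y ++ v.
Proof. by elim: u k => [|x u IH] [|k] //= ku; rewrite IH. Qed.

Lemma set_nth_catr (x0 y : T) k u v :
  set_nth x0 (u ++ v) (size u + k) y = u ++ set_nth x0 v k y.
Proof. by elim: u => //= x u ->. Qed.

Lemma act_at_catl g k u v : (k < size u)%N ->
  act_at g k (u ++ v) = omap (cat^~ v) (act_at g k u).
Proof.
move=> ku; rewrite /act_at onth_cat ku; case: onth => //= x.
by case: (g x) => //= y; rewrite set_nth_catl.
Qed.

Lemma act_at_catr g k u v :
  act_at g (size u + k) (u ++ v) = omap (cat u) (act_at g k v).
Proof.
rewrite /act_at onth_cat ltnNge leq_addr addKn /=; case: (onth v k) => //= x.
by case: (g x) => //= y; rewrite set_nth_catr.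
Qed.

Lemma size_act_at g k u u' : act_at g k u = Some u' -> size u' = size u.
Proof.
rewrite /act_at; case ux: (onth u k) => [x|] //=; case: (g x) => //= y [<-].
(* [set_nth] would pad the word beyond its end, but a letter exists at [k], so the maximum of [k.+1]
   and the length is the length. *)
by rewrite size_set_nth; apply/maxn_idPr; rewrite -onthTE ux.
Qed.

End Positions.

(** * Sums of nonnegative extended integers *)

Section NonnegativeSums.
Context {T : Type}.
Variable F : T -> \bar int.
Implicit Types s : seq T.
Local Open Scope ereal_scope.

Lemma all_sume_ge0 s : all (fun x => 0 <= F x) s -> 0 <= \sum_(x <- s) F x.
Proof.
elim: s => [|x s IH] /=; first by rewrite big_nil.
by rewrite big_cons => /andP[Fx /IH]; apply: adde_ge0.
Qed.

(** Nonnegative terms cannot cancel each other. *)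
Lemma has_gt0_sume s : all (fun x => 0 <= F x) s ->
  has (fun x => 0 < F x) s = (0 < \sum_(x <- s) F x).
Proof.
elim: s => [|x s IH] /=; first by rewrite big_nil ltxx.
case/andP=> Fx Fs; rewrite big_cons IH //; have := all_sume_ge0 Fs.
move: Fx; rewrite !le_eqVlt => /predU1P[<-|Fx]; first by rewrite ltxx add0e.
by move=> /predU1P[<-|Fs']; rewrite Fx ?adde0 ?adde_gt0.
Qed.

(** Nonnegativity rules out [-oo], and a sum of finitely many finite terms is finite. *)
Lemma sume_eqy s : all (fun x => 0 <= F x) s ->
  (\sum_(x <- s) F x == +oo) = has (fun x => F x == +oo) s.
Proof.
elim: s => [|x s IH] /=; first by rewrite big_nil.
case/andP=> Fx /[dup] Fs /IH <-; rewrite big_cons.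
have := all_sume_ge0 Fs.
by case: (F x) Fx (\sum_(_ <- _) _) => [a||] // _ [b||].
Qed.

End NonnegativeSums.

(** * The quasi-crystal structure on a concatenation *)

Section FreeMonoidConcatenation.
Context {V : nmodType} {I : Type} {Q : qc_data V I}.
Implicit Types (i : I) (u v w : free_qc Q).

Lemma word_p_cat i (u v : seq Q) :
  word_p i (u ++ v) =
  if word_p i v is Some k then Some (size u + k)%N else word_p i u.
Proof. exact: last_position_cat. Qed.

Lemma word_q_cat i (u v : seq Q) :
  word_q i (u ++ v) =
  if word_q i u is Some k then Some k else omap (addn (size u)) (word_q i v).
Proof. exact: first_position_cat. Qed.

(** Every position of [u] precedes every position of [v]. The only new source of infinity is thus a
    positive [phi] in [u] together with a positive [eps] in [v]. *)
Lemma word_infinite_cat i (u v : seq Q) :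
  word_infinite i (u ++ v) =
  [|| word_infinite i u, word_infinite i v | isSome (word_q i u) && isSome (word_p i v)].
Proof.
rewrite /word_infinite has_cat word_p_cat word_q_cat.
case: (has _ u) => //=; case: (has _ v) => //=; rewrite ?orbT //.
case pu: (word_p i u) => [a|]; case qu: (word_q i u) => [b|];
case: (word_p i v) => [c|]; case: (word_q i v) => [d|] //=;
rewrite ?ltn_add2l ?orbF ?orbT //.
- by apply: (leq_trans (first_position_lt qu)); rewrite leq_addr.
- by apply: (leq_trans (first_position_lt qu)); rewrite leq_addr.
(* Here [p] lies in [u] and [q] in [v], so [p] comes before [q]. In the other four cases [q] lies in
   [u] and [p] in [v]. *)
- by apply/negbTE; rewrite -leqNgt (leq_trans (ltnW (last_position_lt pu))) // leq_addr.
- by apply: (leq_trans (first_position_lt qu)); rewrite leq_addr.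
- by apply: (leq_trans (first_position_lt qu)); rewrite leq_addr.
Qed.

Lemma finite_factors i (u v : seq Q) : ~~ word_infinite i (u ++ v) ->
  ~~ word_infinite i u /\ ~~ word_infinite i v.
Proof. by rewrite word_infinite_cat; case: word_infinite; case: word_infinite. Qed.

(** [e] acts on the last letter with positive [eps], so [v] has priority; for [f], which acts on the
    first letter with positive [phi], the priority goes to [u]. *)
Lemma free_e_cat i (u v : seq Q) : ~~ word_infinite i (u ++ v) ->
  @qc_e _ _ (free_qc Q) i (u ++ v) =
  if isSome (word_p i v) then omap (cat u) (@qc_e _ _ (free_qc Q) i v)
  else omap (cat^~ v) (@qc_e _ _ (free_qc Q) i u).
Proof.
move=> uvfin; rewrite /= (negbTE uvfin).
have [/negbTE-> /negbTE->] := finite_factors uvfin.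
rewrite word_p_cat.
case: (word_p i v) => [k|] /=; first by rewrite act_at_catr.
by case pu: (word_p i u) => [k|] //=; rewrite act_at_catl // (last_position_lt pu).
Qed.

Lemma free_f_cat i (u v : seq Q) : ~~ word_infinite i (u ++ v) ->
  @qc_f _ _ (free_qc Q) i (u ++ v) =
  if isSome (word_q i u) then omap (cat^~ v) (@qc_f _ _ (free_qc Q) i u)
  else omap (cat u) (@qc_f _ _ (free_qc Q) i v).
Proof.
move=> uvfin; rewrite /= (negbTE uvfin).
have [/negbTE-> /negbTE->] := finite_factors uvfin.
rewrite word_q_cat.
case qu: (word_q i u) => [k|] /=.
  by rewrite act_at_catl // (first_position_lt qu).
by case: (word_q i v) => [k|] //=; rewrite act_at_catr.
Qed.

Lemma size_free_e i (w w' : free_qc Q) : qc_e i w = Some w' -> seq.size w' = seq.size w.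
Proof. by rewrite /=; case: ifP => // _; case: word_p => //= k /size_act_at. Qed.

Lemma size_free_f i (w w' : free_qc Q) : qc_f i w = Some w' -> seq.size w' = seq.size w.
Proof. by rewrite /=; case: ifP => // _; case: word_q => //= k /size_act_at. Qed.

Hypothesis Qsn : seminormal Q.
Local Open Scope ereal_scope.

Lemma seminormal_eps_ge0 i (x : Q) : 0 <= qc_eps i x.
Proof.
have [->//|/eqP/Qsn[[m -> _] _]] := eqVneq (qc_eps i x) +oo.
by rewrite lee_fin.
Qed.

Lemma seminormal_phi_ge0 i (x : Q) : qc_eps i x != +oo -> 0 <= qc_phi i x.
Proof. by move=> /eqP/Qsn[_ [m -> _]]; rewrite lee_fin. Qed.

(** A word that is not infinite has no letter with [eps] equal to [+oo], so its sum, whose terms are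
    nonnegative by seminormality, stays below [+oo]. *)
Lemma word_infiniteE i (w : free_qc Q) : word_infinite i w = (qc_eps i w == +oo).
Proof.
rewrite /=; case: ifPn => [//|]; rewrite negb_or => /andP[fin _].
rewrite sume_eqy ?(negbTE fin) //.
by elim: (w : seq Q) => //= x s ->; rewrite seminormal_eps_ge0.
Qed.

Lemma word_pE i (w : free_qc Q) : ~~ word_infinite i w ->
  isSome (word_p i w) = (0 < qc_eps i w).
Proof.
move=> fin; rewrite /word_p last_position_has /= (negbTE fin) has_gt0_sume //.
by elim: (w : seq Q) => //= x s ->; rewrite seminormal_eps_ge0.
Qed.

(** Seminormality bounds [phi] from below only at letters with [eps] different from [+oo];
    finiteness of the word guarantees this for all its letters. *)
Lemma word_qE i (w : free_qc Q) : ~~ word_infinite i w ->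
  isSome (word_q i w) = (0 < qc_phi i w).
Proof.
move=> fin; rewrite /word_q first_position_has /= (negbTE fin) has_gt0_sume //.
move: fin; rewrite negb_or => /andP[+ _].
elim: (w : seq Q) => //= x s IH; rewrite negb_or => /andP[/seminormal_phi_ge0-> /IH //].
Qed.

(** * The product of two partial isomorphisms *)

Section Product.
Variables S1 S2 : free_qc Q -> free_qc Q -> Prop.
Hypotheses (pS1 : partial_isomorphism S1) (pS2 : partial_isomorphism S2).
Variables n m : nat.

(** Fixing the lengths of the left factors makes both factorizations unique. Two lengths are needed,
    since related words may differ in length. *)
Definition product_rel (w z : seq Q) : Prop :=
  exists w1 w2 z1 z2 : seq Q,
    [/\ w = w1 ++ w2, z = z1 ++ z2, S1 w1 z1, S2 w2 z2
      & seq.size w1 = n /\ seq.size z1 = m].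

Lemma related_word_infinite (S : free_qc Q -> free_qc Q -> Prop) i u v :
  partial_isomorphism S -> S u v -> word_infinite i u = word_infinite i v.
Proof. by move=> pS uv; rewrite !word_infiniteE (pi_eps pS i uv). Qed.

Lemma related_word_p (S : free_qc Q -> free_qc Q -> Prop) i u v :
  partial_isomorphism S -> S u v -> ~~ word_infinite i u ->
  isSome (word_p i u) = isSome (word_p i v).
Proof.
move=> pS uv fin; rewrite !word_pE ?(pi_eps pS i uv) //.
by rewrite -(related_word_infinite i pS uv).
Qed.

Lemma related_word_q (S : free_qc Q -> free_qc Q -> Prop) i u v :
  partial_isomorphism S -> S u v -> ~~ word_infinite i u ->
  isSome (word_q i u) = isSome (word_q i v).
Proof.
move=> pS uv fin; rewrite !word_qE ?(pi_phi pS i uv) //.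
by rewrite -(related_word_infinite i pS uv).
Qed.

(** Infinity of a factor is read off from its [eps]. The crossing condition matters only when both
    factors are finite, and then it is read off from [phi] on the left and [eps] on the right. *)
Lemma product_word_infinite i (w1 w2 z1 z2 : seq Q) : S1 w1 z1 -> S2 w2 z2 ->
  word_infinite i (w1 ++ w2) = word_infinite i (z1 ++ z2).
Proof.
move=> s1 s2; rewrite !word_infinite_cat.
rewrite -(related_word_infinite i pS1 s1) -(related_word_infinite i pS2 s2).
case fin1: (word_infinite i w1) => //; case fin2: (word_infinite i w2) => //=.
by rewrite (related_word_q pS1 s1) ?fin1 // (related_word_p pS2 s2) ?fin2.
Qed.

Lemma finite_sums i w : ~~ word_infinite i w ->
  qc_eps i w = \sum_(x <- w) qc_eps i x /\ qc_phi i w = \sum_(x <- w) qc_phi i x.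
Proof. by move=> /negbTE /= ->. Qed.

Lemma product_partial_isomorphism :
  partial_isomorphism (product_rel : free_qc Q -> free_qc Q -> Prop).
Proof.
split.
- move=> _ z z' [w1 [w2 [z1 [z2 [-> -> s1 s2 [n1 m1]]]]]].
  move=> [w1' [w2' [z1' [z2' [+ -> s1' s2' [n1' m1']]]]]].
  move=> /(cat_injective (etrans n1 (esym n1')))[w1E w2E].
  subst w1' w2'.
  by rewrite (pi_fun pS1 s1 s1') (pi_fun pS2 s2 s2').
- move=> w w' _ [w1 [w2 [z1 [z2 [-> -> s1 s2 [n1 m1]]]]]].
  move=> [w1' [w2' [z1' [z2' [-> + s1' s2' [n1' m1']]]]]].
  move=> /(cat_injective (etrans m1 (esym m1')))[z1E z2E].
  subst z1' z2'.
  by rewrite (pi_inj pS1 s1 s1') (pi_inj pS2 s2 s2').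
- move=> _ _ [w1 [w2 [z1 [z2 [-> -> s1 s2 _]]]]].
  by move: (pi_wt pS1 s1) (pi_wt pS2 s2); rewrite /= !big_cat /= => -> ->.
- move=> i _ _ [w1 [w2 [z1 [z2 [-> -> s1 s2 _]]]]].
  have /= := product_word_infinite i s1 s2.
  case: ifPn => [_ <- //|/[dup] /finite_factors[f1 f2] _ fz].
  have /finite_factors[g1 g2] : ~~ word_infinite i (z1 ++ z2) by rewrite -fz.
  rewrite -fz !big_cat /=.
  move: (pi_eps pS1 i s1) (pi_eps pS2 i s2).
  by rewrite !(proj1 (finite_sums _)) // => -> ->.
- move=> i _ _ [w1 [w2 [z1 [z2 [-> -> s1 s2 _]]]]].
  have /= := product_word_infinite i s1 s2.
  case: ifPn => [_ <- //|/[dup] /finite_factors[f1 f2] _ fz].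
  have /finite_factors[g1 g2] : ~~ word_infinite i (z1 ++ z2) by rewrite -fz.
  rewrite -fz !big_cat /=.
  move: (pi_phi pS1 i s1) (pi_phi pS2 i s2).
  by rewrite !(proj2 (finite_sums _)) // => -> ->.
- move=> i _ _ [w1 [w2 [z1 [z2 [-> -> s1 s2 [n1 m1]]]]]].
  have fz := product_word_infinite i s1 s2.
  case: (boolP (word_infinite i (w1 ++ w2))) => [inf|fin].
    by rewrite /= -fz inf.
  have [f1 f2] := finite_factors fin.
  (* [w2] and [z2] agree on whether [p] exists, so [e] acts on the same factor on both sides. *)
  rewrite !free_e_cat -?fz // -(related_word_p pS2 s2) //.
  case: ifP => _.
    move: (pi_e pS2 i s2).
    case: (@qc_e _ _ (free_qc Q) i w2) (@qc_e _ _ (free_qc Q) i z2) => [w2'|] [z2'|] // s2'.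
    by exists w1, w2', z1, z2'.
  move: (pi_e pS1 i s1).
  case ew: (@qc_e _ _ (free_qc Q) i w1) => [w1'|];
    case ez: (@qc_e _ _ (free_qc Q) i z1) => [z1'|] // s1'.
  (* The left factors have changed, but [e] preserves length, so the cuts remain at [n] and [m]. *)
  by exists w1', w2, z1', z2; split=> //; rewrite (size_free_e ew) (size_free_e ez).
- move=> i _ _ [w1 [w2 [z1 [z2 [-> -> s1 s2 [n1 m1]]]]]].
  have fz := product_word_infinite i s1 s2.
  case: (boolP (word_infinite i (w1 ++ w2))) => [inf|fin].
    by rewrite /= -fz inf.
  have [f1 f2] := finite_factors fin.
  rewrite !free_f_cat -?fz // -(related_word_q pS1 s1) //.
  case: ifP => _.
    move: (pi_f pS1 i s1).
    case ew: (@qc_f _ _ (free_qc Q) i w1) => [w1'|];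
      case ez: (@qc_f _ _ (free_qc Q) i z1) => [z1'|] // s1'.
    by exists w1', w2, z1', z2; split=> //; rewrite (size_free_f ew) (size_free_f ez).
  move: (pi_f pS2 i s2).
  case: (@qc_f _ _ (free_qc Q) i w2) (@qc_f _ _ (free_qc Q) i z2) => [w2'|] [z2'|] // s2'.
  by exists w1, w2', z1, z2'.
Qed.

End Product.
End FreeMonoidConcatenation.

(** * The congruence axioms *)

Unset Implicit Arguments.
Set Strict Implicit.

Theorem theorem7p3 (R : realType) (V : vectType R) (ip : {dot V for idfun})
    (Phi : set V) (I : finType) (alpha : I -> V) (Lambda : set V)
    (HPhi : root_system ip Phi) (Halpha : simple_roots Phi alpha)
    (HLambda : weight_lattice ip Phi Lambda)
    (Q : qc_data V I) (HQ : quasi_crystal ip alpha Lambda Q)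
    (Hsn : seminormal Q) :
  qc_monoid_congruence (@hypoplactic V I Q).
Proof.
have hypoP (u v : free_qc Q) : hypoplactic u v <->
    exists2 S : free_qc Q -> free_qc Q -> Prop, partial_isomorphism S & S u v.
  exact: component_isomorphismP.
split.
- split=> [u|u v|u v w].
  + by apply/hypoP; exists eq => //; apply: partial_isomorphism_eq.
  + move=> /hypoP[S pS uv]; apply/hypoP; exists (fun y x => S x y) => //.
    exact: partial_isomorphism_sym.
  + move=> /hypoP[S pS uv] /hypoP[T pT vw]; apply/hypoP.
    exists (fun x z => exists2 y, S x y & T y z); last by exists v.
    exact: partial_isomorphism_comp.
- by move=> u v /hypoP[S pS /(pi_wt pS)].
- by move=> u v /hypoP[S pS uv] i; apply: pi_eps uv.
- by move=> u v /hypoP[S pS uv] i; apply: pi_phi uv.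
- move=> u v i u' /hypoP[S pS uv] uu'; move: (pi_e pS i uv); rewrite uu'.
  (* The relation [S] witnessing the equivalence of [u] and [v] also relates their images, so it
     serves again. *)
  by case: (qc_e i v) => [v'|] //= u'v'; exists v' => //; apply/hypoP; exists S.
- move=> u v i u' /hypoP[S pS uv] uu'; move: (pi_f pS i uv); rewrite uu'.
  by case: (qc_f i v) => [v'|] //= u'v'; exists v' => //; apply/hypoP; exists S.
- move=> x1 y1 x2 y2 /hypoP[S pS xy1] /hypoP[T pT xy2]; apply/hypoP.
  (* The cuts are placed at the ends of [x1] and [y1], so the given factorizations are the ones
     being related. *)
  exists (product_rel S T (seq.size x1) (seq.size y1)).
    exact: product_partial_isomorphism.
  by exists x1, x2, y1, y2.
Qed.
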